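(* For every $n\ge 2$, $\mathsf{GAC}_n\equiv_{\mathrm{sW}}\mathsf{EMB}_n\equiv_{\mathrm{sW}}\mathsf{C}_\mathbb{N}$.
   Context: A Weihrauch problem is a relation between instances and solutions (coded as elements of $\mathbb{N}^\mathbb{N}$ or $\mathbb{N}$). $P\le_{\mathrm{sW}}Q$ if there are computable functionals $\Phi,\Psi$ such that for every instance $S$ of $P$, $\Phi(S)$ is an instance of $Q$ and for every solution $R$ of $\Phi(S)$, $\Psi(R)$ is a solution of $S$; $\equiv_{\mathrm{sW}}$ is the induced equivalence. $\mathsf{C}_\mathbb{N}$: instances are non-surjective $f\colon\mathbb{N}\to\mathbb{N}$, solutions are $n\notin\operatorname{range}(f)$. $\mathsf{GAC}_n$: instances are countable graphs with exactly $n$ connected components; solutions are maximal antichains (maximal sets of vertices no two of which are connected by a path). $\mathsf{EMB}_n$: instances are countable e-matroids having a basis of size $n$; solutions are bases. An e-matroid is $(M,e)$ with $M\subseteq\mathbb{N}$, $e\colon\mathbb{N}\to$ finite subsets of $M$, such that $e(k)\ne\emptyset$ for all $k$, every finite $Y\subseteq M$ containing some $e(k)$ is in the range of $e$, and for finite $X,Y\subseteq M$ with $|X|<|Y|$ not in the range of $e$, some $y\in Y$ has $X\cup\{y\}$ not in the range of $e$. A basis is $B\subseteq M$ with $e(k)\not\subseteq B$ for all $k$ such that for each $x\in M\setminus B$ some $e(k)\subseteq B\cup\{x\}$.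
   Formalization: In the exchange axiom of e-matroids the element y is required to lie in Y but not in X (the usual matroid axiom); with y allowed in X, as literally written, the claim EMB_2 ≤ C_N fails. *)

(* Defs.v *)
From mathcomp Require Import all_boot finmap all_classical.

Set Implicit Arguments.
Unset Strict Implicit.
Unset Printing Implicit Defensive.

Local Open Scope classical_set_scope.
Local Open Scope card_scope.

Definition baire := nat -> nat.

(** * Partial recursive functions with an oracle

   Kleene's schemes (zero, successor, projections, composition, primitive
   recursion, minimization) together with the oracle. Arguments are passed as a
   list; a missing argument of [RSucc], [RProj] or [ROracle] is read as 0. *)

Inductive rcode : Type :=
| RZero
| RSucc
| RProj of nat
| ROracle
| RComp of rcode & seq rcode
| RPrec of rcode & rcode
| RMu of rcode.

(* [reval p c xs y]: with oracle [p], the program [c] halts on [xs] with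
   value [y]. *)
Inductive reval (p : baire) : rcode -> seq nat -> nat -> Prop :=
| reval_zero xs : reval p RZero xs 0
| reval_succ xs : reval p RSucc xs (nth 0 xs 0).+1
| reval_proj i xs : reval p (RProj i) xs (nth 0 xs i)
| reval_oracle xs : reval p ROracle xs (p (nth 0 xs 0))
| reval_comp c ds xs ys y :
    revals p ds xs ys -> reval p c ys y -> reval p (RComp c ds) xs y
| reval_prec0 c d xs y :
    reval p c xs y -> reval p (RPrec c d) (0 :: xs) y
| reval_precS c d m xs z y :
    reval p (RPrec c d) (m :: xs) z -> reval p d [:: m, z & xs] y ->
    reval p (RPrec c d) (m.+1 :: xs) y
| reval_mu c xs m (v : nat -> nat) :
    reval p c (m :: xs) 0 ->
    (forall i, i < m -> reval p c (i :: xs) (v i).+1) ->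
    reval p (RMu c) xs m
with revals (p : baire) : seq rcode -> seq nat -> seq nat -> Prop :=
| revals_nil xs : revals p [::] xs [::]
| revals_cons c cs xs y ys :
    reval p c xs y -> revals p cs xs ys -> revals p (c :: cs) xs (y :: ys).

(* The partial computable functional with program [c] is defined at [p], with
   value [q]. *)
Definition computes (c : rcode) (p q : baire) : Prop :=
  forall k, reval p c [:: k] (q k).

(** * Weihrauch problems

   Instances and solutions are mathematical objects, and [inst_name p x] (resp.
   [sol_name r a]) says that the element [p] (resp. [r]) of Baire space is a
   code of [x] (resp. [a]). *)

Record problem := Problem {
  inst : Type;
  sol : Type;
  inst_name : baire -> inst -> Prop;
  sol_name : baire -> sol -> Prop;
  is_instance : inst -> Prop;
  is_solution : inst -> sol -> Prop
}.

Definition sW_reducible (P Q : problem) : Prop :=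
  exists Phi Psi : rcode,
    forall (p : baire) (x : inst P), inst_name p x -> is_instance x ->
    exists (q : baire) (y : inst Q),
      [/\ computes Phi p q, inst_name q y, is_instance y &
        forall (r : baire) (b : sol Q), sol_name r b -> is_solution y b ->
        exists (s : baire) (a : sol P),
          [/\ computes Psi r s, sol_name s a & is_solution x a]].

Definition sW_equiv (P Q : problem) : Prop :=
  sW_reducible P Q /\ sW_reducible Q P.

(** * Codes *)

(* The Cantor pairing bijection. *)
Definition cantor_pair (u v : nat) : nat := 'C((u + v).+1, 2) + u.

Definition even_part (p : baire) : baire := fun k => p k.*2.
Definition odd_part (p : baire) : baire := fun k => p k.*2.+1.

Definition fun_name (p : baire) (f : nat -> nat) : Prop := forall k, p k = f k.

(* The usual representation of the discrete space of natural numbers: only the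
   first entry of a name is relevant. *)
Definition nat_name (p : baire) (m : nat) : Prop := p 0 = m.

(* Characteristic functions; the boolean is coerced to 0 or 1. *)
Definition set_name (p : baire) (A : set nat) : Prop :=
  forall x, p x = (x \in A).

Definition rel_name (p : baire) (E : set (nat * nat)) : Prop :=
  forall u v, p (cantor_pair u v) = ((u, v) \in E).

(* The canonical index of a finite set. *)
Definition fset_index (X : {fset nat}) : nat := \sum_(i <- X) 2 ^ i.

(** * Closed choice on the natural numbers *)

Definition C_N : problem := {|
  inst := nat -> nat;
  sol := nat;
  inst_name := fun_name;
  sol_name := nat_name;
  is_instance := fun f => exists m, ~ range f m;
  is_solution := fun f m => ~ range f m
|}.

(** * Graphs *)

Record graph := Graph {
  vertices : set nat;
  edges : set (nat * nat);
  edges_vertices : forall u v, edges (u, v) -> vertices u /\ vertices v;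
  edges_sym : forall u v, edges (u, v) -> edges (v, u);
  edges_irrefl : forall u, ~ edges (u, u)
}.

Definition joined (G : graph) (u v : nat) : Prop :=
  exists s : seq nat, path (fun x y => (x, y) \in edges G) u s /\ last u s = v.

Definition component (G : graph) (u : nat) : set nat :=
  [set v | joined G u v].

Definition components (G : graph) : set (set nat) :=
  component G @` vertices G.

Definition antichain (G : graph) (A : set nat) : Prop :=
  A `<=` vertices G /\ forall u v, A u -> A v -> u <> v -> ~ joined G u v.

Definition maximal_antichain (G : graph) (A : set nat) : Prop :=
  antichain G A /\ forall B, antichain G B -> A `<=` B -> B = A.

Definition graph_name (p : baire) (G : graph) : Prop :=
  set_name (even_part p) (vertices G) /\ rel_name (odd_part p) (edges G).

Definition GAC (n : nat) : problem := {|
  inst := graph;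
  sol := set nat;
  inst_name := graph_name;
  sol_name := set_name;
  is_instance := fun G => components G #= `I_n;
  is_solution := maximal_antichain
|}.

(** * e-matroids *)

(* In the exchange axiom the element [y] has to be new: for [y] in [X] the
   conclusion would hold trivially. *)
Record ematroid := EMatroid {
  ground : set nat;
  dep : nat -> {fset nat};
  dep_ground : forall k, [set` dep k] `<=` ground;
  dep_neq0 : forall k, dep k <> fset0;
  dep_up : forall Y : {fset nat}, [set` Y] `<=` ground ->
    (exists k, (dep k `<=` Y)%fset) -> range dep Y;
  dep_exchange : forall X Y : {fset nat},
    [set` X] `<=` ground -> [set` Y] `<=` ground -> #|` X| < #|` Y| ->
    ~ range dep X -> ~ range dep Y ->
    exists y : nat, [/\ y \in Y, y \notin X & ~ range dep (y |` X)%fset]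
}.

Definition basis (N : ematroid) (B : set nat) : Prop :=
  [/\ B `<=` ground N,
      forall k, ~ [set` dep N k] `<=` B &
      forall x, (ground N `\` B) x ->
        exists k, [set` dep N k] `<=` B `|` [set x]].

Definition ematroid_name (p : baire) (N : ematroid) : Prop :=
  set_name (even_part p) (ground N) /\
  forall k, odd_part p k = fset_index (dep N k).

Definition EMB (n : nat) : problem := {|
  inst := ematroid;
  sol := set nat;
  inst_name := ematroid_name;
  sol_name := set_name;
  is_instance := fun N => exists B, basis N B /\ B #= `I_n;
  is_solution := basis
|}.

(* Main.v *)
(* [GAC n <= EMB n <= C_N <= GAC n] closes the circle.

   Choosing one vertex in each component is choosing a basis of the matroid in
   which joined vertices are parallel; its dependent sets are enumerated through
   the paths that witness them.

   In a matroid with a basis of size n, the bases are the independent sets of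
   size n, and failing to be such a set is witnessed by finite information. So
   their canonical indices are the numbers outside the range of a function
   computable from the matroid.

   For f not surjective, let each vertex of a graph carry a guess of the least
   number outside the range of f, vertices with the same guess being joined.
   When f takes a value, the vertices guessing it become joined to a fixed
   component. A maximal antichain has a vertex carrying the right guess, and
   this is the largest guess that occurs in the antichain. *)
Require Import Defs.
From mathcomp Require Import all_boot finmap all_classical.

Set Implicit Arguments.
Unset Strict Implicit.
Unset Printing Implicit Defensive.

Local Open Scope classical_set_scope.
Local Open Scope card_scope.

(** * Computable functionals *)

Scheme reval_mutind := Minimality for reval Sort Prop
  with revals_mutind := Minimality for revals Sort Prop.

(** Each oracle call is replaced by a run of [c]. The projection cuts the argument list down to its
    head, because [computes] speaks of one-element lists only. *)
Fixpoint oracle_subst (c d : rcode) : rcode :=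
  match d with
  | ROracle => RComp c [:: RProj 0]
  | RComp d1 ds => RComp (oracle_subst c d1) (map (oracle_subst c) ds)
  | RPrec d1 d2 => RPrec (oracle_subst c d1) (oracle_subst c d2)
  | RMu d1 => RMu (oracle_subst c d1)
  | _ => d
  end.

Lemma reval_oracle_subst c p q : computes c p q ->
  forall d xs y, reval q d xs y -> reval p (oracle_subst c d) xs y.
Proof.
move=> cpq d xs y; apply: (reval_mutind
  (P := fun d xs y => reval p (oracle_subst c d) xs y)
  (P0 := fun ds xs ys => revals p (map (oracle_subst c) ds) xs ys)) =>
  {d xs y} /=; try by [constructor].
- move=> xs; apply: reval_comp (cpq _).
  by apply: revals_cons; [exact: reval_proj|exact: revals_nil].
- by move=> d ds xs ys y _ IHds _ IHd; apply: reval_comp IHd.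
- by move=> d1 d2 m xs z y _ IH1 _ IH2; apply: reval_precS IH2.
- by move=> d xs m v _ IH0 _ IH; apply: reval_mu IH.
Qed.

Lemma computes_comp c d p q r :
  computes c p q -> computes d q r -> computes (oracle_subst c d) p r.
Proof. by move=> cpq dqr k; apply: reval_oracle_subst cpq _ _ _ (dqr k). Qed.

(** Forward programs compose in the given order and backward ones in reverse. A backward program
    never reads the original instance, so no two oracles have to be combined. *)
Lemma sW_reducible_trans P Q R :
  sW_reducible P Q -> sW_reducible Q R -> sW_reducible P R.
Proof.
move=> [F1 [B1 PQ]] [F2 [B2 QR]].
exists (oracle_subst F1 F2), (oracle_subst B2 B1) => p x px xP.
have [q [y [Fpq qy yQ solQ]]] := PQ _ _ px xP.
have [q' [y' [Fqq' qy' yR solR]]] := QR _ _ qy yQ.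
exists q', y'; split=> //; first exact: computes_comp Fqq'.
move=> r b rb bR.
have [s [a [Brs sa aQ]]] := solR _ _ rb bR.
have [s' [a' [Bss' sa' aP]]] := solQ _ _ sa aQ.
by exists s', a'; split=> //; apply: computes_comp Bss'.
Qed.

(** One program serves all oracles. The arity is fixed because recursion and search put their own
    variables in front of the parameters. *)
Definition computable (a : nat) (F : baire -> seq nat -> nat) : Prop :=
  exists c, forall p xs, size xs = a -> reval p c xs (F p xs).

Lemma computable_ext a F F' :
  (forall p xs, size xs = a -> F p xs = F' p xs) ->
  computable a F' -> computable a F.
Proof.
by move=> eqF [c cF]; exists c => p xs xsa; rewrite eqF //; apply: cF.
Qed.

Lemma computable_var a i : computable a (fun _ xs => nth 0 xs i).
Proof. by exists (RProj i) => p xs _; exact: reval_proj. Qed.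

Lemma computable_oracle a M : computable a M ->
  computable a (fun p xs => p (M p xs)).
Proof.
move=> [c cM]; exists (RComp ROracle [:: c]) => p xs xsa.
apply: (@reval_comp _ _ _ _ [:: M p xs]); last exact: (reval_oracle p [:: _]).
by apply: revals_cons; [exact: cM|exact: revals_nil].
Qed.

Lemma computable_succ a M : computable a M ->
  computable a (fun p xs => (M p xs).+1).
Proof.
move=> [c cM]; exists (RComp RSucc [:: c]) => p xs xsa.
apply: (@reval_comp _ _ _ _ [:: M p xs]); last exact: (reval_succ p [:: _]).
by apply: revals_cons; [exact: cM|exact: revals_nil].
Qed.

Lemma computable_const a k : computable a (fun _ _ => k).
Proof.
elim: k => [|k]; first by exists RZero => p xs _; exact: reval_zero.
exact: computable_succ.
Qed.

Lemma computable_app a f M : computable 1 (fun p xs => f p (nth 0 xs 0)) ->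
  computable a M -> computable a (fun p xs => f p (M p xs)).
Proof.
move=> [d df] [c cM]; exists (RComp d [:: c]) => p xs xsa.
apply: (@reval_comp _ _ _ _ [:: M p xs]); last exact: (df p [:: _]).
by apply: revals_cons; [exact: cM|exact: revals_nil].
Qed.

Lemma revals_proj p xs l : revals p (map RProj l) xs (map (nth 0 xs) l).
Proof.
elim: l => [|i l IH] /=; first exact: revals_nil.
by apply: revals_cons IH; exact: reval_proj.
Qed.

Lemma revals_proj_iota p xs : revals p (map RProj (iota 0 (size xs))) xs xs.
Proof.
have := revals_proj p xs (iota 0 (size xs)).
by rewrite map_nth_iota0 ?take_size.
Qed.

Lemma computable_rename a l F : computable (size l) F ->
  computable a (fun p ys => F p (map (nth 0 ys) l)).
Proof.
move=> [c cF]; exists (RComp c (map RProj l)) => p ys _.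
by apply: reval_comp (revals_proj p ys l) _; apply: cF; rewrite size_map.
Qed.

Lemma computable_weak a b F : computable a F ->
  computable (b + a) (fun p ys => F p (drop b ys)).
Proof.
move=> cF; apply: computable_ext (_ : computable (b + a)
  (fun p ys => F p (map (nth 0 ys) (iota b a)))); last first.
  by apply: computable_rename; rewrite size_iota.
move=> p ys ysE; have sz : a = size ys - b by rewrite ysE addKn.
by rewrite map_nth_iota sz// -size_drop take_size.
Qed.

Lemma computable_prec a B N (G : baire -> nat -> nat -> seq nat -> nat) :
  computable a B -> computable a N ->
  computable a.+2 (fun p ys => G p (nth 0 ys 0) (nth 0 ys 1) (drop 2 ys)) ->
  computable a (fun p xs => iteri (N p xs) (fun m z => G p m z xs) (B p xs)).
Proof.
move=> [b bB] [c cN] [d dG].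
(* The bound is computed first and put in front of the parameters, which the projections copy. *)
exists (RComp (RPrec b d) (c :: map RProj (iota 0 a))) => p xs xsa.
apply: (@reval_comp _ _ _ _ (N p xs :: xs)).
  by apply: revals_cons; [exact: cN|rewrite -xsa; exact: revals_proj_iota].
elim: (N p xs) => [|m IH]; first by apply: reval_prec0; exact: bB.
apply: reval_precS IH _ => /=.
have := dG p [:: m, iteri m (fun m z => G p m z xs) (B p xs) & xs].
by rewrite /= drop0; apply; rewrite xsa.
Qed.

(* Definedness of unbounded search depends on the oracle, so it is stated for a
   single input. *)
Lemma reval_search a F H :
  computable a.+1 F -> computable a.+1 H ->
  exists c, forall p xs m, size xs = a -> F p (m :: xs) = 0 ->
    (forall i, i < m -> F p (i :: xs) <> 0) -> reval p c xs (H p (m :: xs)).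
Proof.
move=> [c cF] [d dH]; exists (RComp d (RMu c :: map RProj (iota 0 a))).
move=> p xs m xsa Fm Fi; apply: (@reval_comp _ _ _ _ (m :: xs)); last first.
  by apply: dH; rewrite /= xsa.
apply: revals_cons; last by rewrite -xsa; exact: revals_proj_iota.
(* The rule for minimization wants the earlier values as successors, hence the predecessor. *)
apply: (@reval_mu _ _ _ _ (fun i => (F p (i :: xs)).-1)).
  by rewrite -Fm; apply: cF; rewrite /= xsa.
move=> i /Fi/eqP; rewrite -lt0n => /prednK ->.
by apply: cF; rewrite /= xsa.
Qed.

(** * Arithmetic, bounded sums and decidable conditions *)

Lemma computable_add a M N : computable a M -> computable a N ->
  computable a (fun p xs => M p xs + N p xs).
Proof.
move=> cM cN; apply: computable_ext (_ : computable a
  (fun p xs => iteri (N p xs) (fun _ z => z.+1) (M p xs))).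
  by move=> p xs _; elim: (N p xs) => [|k]; rewrite ?addn0 // addnS /= => ->.
apply: (computable_prec (G := fun _ _ z _ => z.+1)) => //.
by apply/computable_succ/computable_var.
Qed.

(** A recursion that returns its counter ends with the last counter value, and with 0 if there is no
    round. *)
Lemma computable_pred a M : computable a M ->
  computable a (fun p xs => (M p xs).-1).
Proof.
move=> cM; apply: computable_ext (_ : computable a
  (fun p xs => iteri (M p xs) (fun m _ => m) 0)).
  by move=> p xs _; case: (M p xs).
apply: (computable_prec (G := fun _ m _ _ => m)) => //.
  exact: computable_const.
exact: computable_var.
Qed.

Lemma computable_sub a M N : computable a M -> computable a N ->
  computable a (fun p xs => M p xs - N p xs).
Proof.
move=> cM cN; apply: computable_ext (_ : computable a
  (fun p xs => iteri (N p xs) (fun _ z => z.-1) (M p xs))).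
  by move=> p xs _; elim: (N p xs) => [|k]; rewrite ?subn0 // subnS /= => ->.
apply: (computable_prec (G := fun _ _ z _ => z.-1)) => //.
by apply/computable_pred/computable_var.
Qed.

Lemma computable_mul a M N : computable a M -> computable a N ->
  computable a (fun p xs => M p xs * N p xs).
Proof.
move=> cM cN; apply: computable_ext (_ : computable a
  (fun p xs => iteri (N p xs) (fun _ z => z + M p xs) 0)).
  by move=> p xs _; elim: (N p xs) => [|k] /=; rewrite ?muln0 // mulnSr => ->.
apply: (computable_prec (G := fun p _ z xs => z + M p xs)) => //.
  exact: computable_const.
apply: computable_add; first exact: computable_var.
exact: (@computable_weak a 2 M cM).
Qed.

Lemma computable_sum a N G : computable a N ->
  computable a.+1 (fun p ys => G p (nth 0 ys 0) (drop 1 ys)) ->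
  computable a (fun p xs => \sum_(0 <= i < N p xs) G p i xs).
Proof.
move=> cN cG; apply: computable_ext (_ : computable a
  (fun p xs => iteri (N p xs) (fun m z => z + G p m xs) 0)).
  move=> p xs _; elim: (N p xs) => [|k] /=; first by rewrite big_geq.
  by rewrite big_nat_recr //= => ->.
apply: (computable_prec (G := fun p m z xs => z + G p m xs)) => //.
  exact: computable_const.
apply: computable_add; first exact: computable_var.
(* Position 1 holds the partial sum, which the summand must not see. *)
have : computable (size (0 :: iota 2 a))
    (fun p ys => G p (nth 0 ys 0) (drop 1 ys)).
  by rewrite /= size_iota.
move=> /(computable_rename a.+2); apply: computable_ext => p ys ysE /=.
rewrite map_nth_iota; last by rewrite ysE subn2.
by rewrite drop0 take_oversize // size_drop ysE subn2.
Qed.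

Lemma computable_not a (b : baire -> seq nat -> bool) :
  computable a (fun p xs => b p xs) -> computable a (fun p xs => ~~ b p xs).
Proof.
move=> cb; apply: computable_ext (_ : computable a (fun p xs => 1 - b p xs)).
  by move=> p xs _; case: (b p xs).
by apply: computable_sub => //; exact: computable_const.
Qed.

Lemma computable_and a (b c : baire -> seq nat -> bool) :
  computable a (fun p xs => b p xs) -> computable a (fun p xs => c p xs) ->
  computable a (fun p xs => b p xs && c p xs).
Proof.
move=> cb cc.
apply: computable_ext (_ : computable a (fun p xs => b p xs * c p xs)).
  by move=> p xs _; case: (b p xs); rewrite ?mul1n.
exact: computable_mul.
Qed.

Lemma computable_or a (b c : baire -> seq nat -> bool) :
  computable a (fun p xs => b p xs) -> computable a (fun p xs => c p xs) ->
  computable a (fun p xs => b p xs || c p xs).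
Proof.
move=> cb cc; apply: computable_ext (_ : computable a
  (fun p xs => ~~ (~~ b p xs && ~~ c p xs))).
  by move=> p xs _; rewrite -negb_or negbK.
by apply/computable_not/computable_and; exact: computable_not.
Qed.

Lemma computable_eq a M N : computable a M -> computable a N ->
  computable a (fun p xs => M p xs == N p xs).
Proof.
move=> cM cN; apply: computable_ext (_ : computable a
  (fun p xs => 1 - ((M p xs - N p xs) + (N p xs - M p xs)))).
  move=> p xs _; rewrite eqn_leq -!subn_eq0 -addn_eq0.
  by case: (_ + _).
apply: computable_sub; first exact: computable_const.
by apply: computable_add; exact: computable_sub.
Qed.

Lemma computable_leq a M N : computable a M -> computable a N ->
  computable a (fun p xs => M p xs <= N p xs).
Proof.
by move=> cM cN; apply/computable_eq/computable_const; exact: computable_sub.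
Qed.

Lemma computable_if a (b : baire -> seq nat -> bool) M N :
  computable a (fun p xs => b p xs) -> computable a M -> computable a N ->
  computable a (fun p xs => if b p xs then M p xs else N p xs).
Proof.
move=> cb cM cN; apply: computable_ext (_ : computable a
  (fun p xs => b p xs * M p xs + ~~ b p xs * N p xs)).
  by move=> p xs _; case: (b p xs); rewrite ?mul1n ?addn0.
by apply: computable_add; apply: computable_mul => //; exact: computable_not.
Qed.

Lemma computable_all a N (b : baire -> nat -> seq nat -> bool) :
  computable a N ->
  computable a.+1 (fun p ys => b p (nth 0 ys 0) (drop 1 ys)) ->
  computable a (fun p xs => all (fun i => b p i xs) (iota 0 (N p xs))).
Proof.
move=> cN cb; apply: computable_ext (_ : computable a
  (fun p xs => (\sum_(0 <= i < N p xs) ~~ b p i xs) == 0)).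
  move=> p xs _; congr nat_of_bool; rewrite sum_nat_seq_eq0 /index_iota subn0.
  by apply: eq_all => i /=; case: (b p i xs).
apply/computable_eq/computable_const.
apply: (computable_sum (G := fun p i xs => ~~ b p i xs)) => //.
exact: computable_not.
Qed.

Lemma computable_has a N (b : baire -> nat -> seq nat -> bool) :
  computable a N ->
  computable a.+1 (fun p ys => b p (nth 0 ys 0) (drop 1 ys)) ->
  computable a (fun p xs => has (fun i => b p i xs) (iota 0 (N p xs))).
Proof.
move=> cN cb; apply: computable_ext (_ : computable a
  (fun p xs => ~~ all (fun i => ~~ b p i xs) (iota 0 (N p xs)))).
  move=> p xs _; rewrite -has_predC; congr nat_of_bool.
  by apply: eq_has => i /=; rewrite negbK.
apply/computable_not.
apply: (computable_all (b := fun p i xs => ~~ b p i xs)) => //.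
exact: computable_not.
Qed.

Lemma computable_iter a N G B : computable a B -> computable a N ->
  computable a.+1 (fun p ys => G p (nth 0 ys 0) (drop 1 ys)) ->
  computable a (fun p xs => iter (N p xs) (fun z => G p z xs) (B p xs)).
Proof.
move=> cB cN cG; apply: computable_ext (_ : computable a
  (fun p xs => iteri (N p xs) (fun _ z => G p z xs) (B p xs))).
  by move=> p xs _; elim: (N p xs) => //= k ->.
apply: (computable_prec (G := fun p _ z xs => G p z xs)) => //.
have := @computable_weak a.+1 1 _ cG; apply: computable_ext => p ys _.
by rewrite nth_drop drop_drop.
Qed.

(** A sum with a single possibly nonzero term: a code bounds both components of its pair, so
    decoding needs only a bounded double sum. *)
Definition unpair (h : nat -> nat -> nat) (z : nat) : nat :=
  \sum_(0 <= u < z.+1) \sum_(0 <= v < z.+1) h u v * (cantor_pair u v == z).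

Definition unpair1 := unpair (fun u _ => u).
Definition unpair2 := unpair (fun _ v => v).

Definition bit (x i : nat) : bool := odd (iter i half x).

(** The binomial coefficient is the sum of the numbers up to [u + v]. *)
Lemma computable_pair a M N : computable a M -> computable a N ->
  computable a (fun p xs => cantor_pair (M p xs) (N p xs)).
Proof.
move=> cM cN; apply: computable_ext (_ : computable a
  (fun p xs => \sum_(0 <= i < (M p xs + N p xs).+1) i + M p xs)).
  by move=> p xs _; rewrite bin2_sum.
apply: computable_add => //.
apply: (computable_sum (G := fun _ i _ => i)); last exact: computable_var.
by apply/computable_succ/computable_add.
Qed.

Lemma computable_odd a M : computable a M ->
  computable a (fun p xs => odd (M p xs)).
Proof.
move=> cM; apply: computable_ext (_ : computable a
  (fun p xs => iter (M p xs) (fun z => 1 - z) 0)).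
  by move=> p xs _; elim: (M p xs) => //= k <-; case: odd.
apply: (computable_iter (G := fun _ z _ => 1 - z)) => //.
  exact: computable_const.
by apply: computable_sub; [exact: computable_const|exact: computable_var].
Qed.

(** Half of a number, rounded down, counts the odd numbers below it. *)
Lemma computable_half a M : computable a M ->
  computable a (fun p xs => (M p xs)./2).
Proof.
move=> cM; apply: computable_ext (_ : computable a
  (fun p xs => \sum_(0 <= i < M p xs) odd i)).
  move=> p xs _; elim: (M p xs) => [|k]; first by rewrite big_geq.
  by rewrite big_nat_recr //= => <-; rewrite uphalf_half addnC.
by apply: (computable_sum (G := fun _ i _ => odd i)) => //;
  exact/computable_odd/computable_var.
Qed.

Lemma computable_bit a M N : computable a M -> computable a N ->
  computable a (fun p xs => bit (M p xs) (N p xs)).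
Proof.
move=> cM cN; apply: computable_odd.
apply: (computable_iter (G := fun _ z _ => z./2)) => //.
exact/computable_half/computable_var.
Qed.

(** In the three-place hypothesis the inner index [v] comes first, then the outer index [u], then
    the number to decode. *)
Lemma computable_unpair a h M :
  computable 3 (fun _ ys => h (nth 0 ys 1) (nth 0 ys 0)) ->
  computable a M -> computable a (fun p xs => unpair h (M p xs)).
Proof.
move=> ch cM; apply: (@computable_app _ (fun _ => unpair h)) cM.
apply: (@computable_sum _ _ (fun _ u xs => \sum_(0 <= v < (nth 0 xs 0).+1)
  h u v * (cantor_pair u v == nth 0 xs 0))).
  exact/computable_succ/computable_var.
apply: (@computable_sum _ _ (fun _ v ys => h (nth 0 ys 0) v *
  (cantor_pair (nth 0 ys 0) v == nth 0 (drop 1 ys) 0))).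
  apply: computable_succ; apply: computable_ext (computable_var 2 1) => p xs _.
  by rewrite nth_drop.
apply: computable_mul.
  by apply: computable_ext ch => p xs _; rewrite nth_drop.
apply: computable_eq.
  apply: computable_pair; last exact: computable_var.
  by apply: computable_ext (computable_var 3 1) => p xs _; rewrite nth_drop.
by apply: computable_ext (computable_var 3 2) => p xs _; rewrite !nth_drop.
Qed.

Lemma computable_unpair1 a M : computable a M ->
  computable a (fun p xs => unpair1 (M p xs)).
Proof. by apply: computable_unpair; exact: computable_var. Qed.

Lemma computable_unpair2 a M : computable a M ->
  computable a (fun p xs => unpair2 (M p xs)).
Proof. by apply: computable_unpair; exact: computable_var. Qed.

(** Recursion on the outermost operation of the body. Variables under several binders appear as
    [nth] of nested [drop] and are first brought to a single position; goals of unknown shape are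
    left open. *)
Ltac computable_tac :=
  lazymatch goal with
  | |- computable _ (fun p xs => nth 0 xs _) => apply: computable_var
  | |- computable _ (fun p xs => nth 0 (drop _ _) _) =>
      apply: computable_ext;
        [by move=> ? ? _; rewrite ?nth_drop; reflexivity | apply: computable_var]
  | |- computable _ (fun _ _ => ?k) => apply: computable_const
  | |- computable _ (fun p xs => (@?M p xs).-1) =>
      apply: (@computable_pred _ M); computable_tac
  | |- computable _ (fun p xs => (@?M p xs).*2) =>
      apply: computable_ext;
        [by move=> ? ? _; rewrite -addnn; reflexivity
        |apply: (@computable_add _ M M); computable_tac]
  | |- computable _ (fun p xs => (@?M p xs)./2) =>
      apply: (@computable_half _ M); computable_tac
  | |- computable _ (fun p xs => (@?M p xs).+1) =>
      apply: (@computable_succ _ M); computable_tac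
  | |- computable _ (fun p xs => (@?M p xs) + (@?N p xs)) =>
      apply: (@computable_add _ M N); computable_tac
  | |- computable _ (fun p xs => (@?M p xs) - (@?N p xs)) =>
      apply: (@computable_sub _ M N); computable_tac
  | |- computable _ (fun p xs => (@?M p xs) * (@?N p xs)) =>
      apply: (@computable_mul _ M N); computable_tac
  | |- computable _ (fun p xs => nat_of_bool (~~ (@?M p xs))) =>
      apply: (@computable_not _ M); computable_tac
  | |- computable _ (fun p xs => nat_of_bool ((@?M p xs) && (@?N p xs))) =>
      apply: (@computable_and _ M N); computable_tac
  | |- computable _ (fun p xs => nat_of_bool ((@?M p xs) || (@?N p xs))) =>
      apply: (@computable_or _ M N); computable_tac
  | |- computable _ (fun p xs => nat_of_bool ((@?M p xs) == (@?N p xs))) =>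
      apply: (@computable_eq _ M N); computable_tac
  | |- computable _ (fun p xs => nat_of_bool ((@?M p xs) <= (@?N p xs))) =>
      apply: (@computable_leq _ M N); computable_tac
  | |- computable _ (fun p xs => nat_of_bool (odd (@?M p xs))) =>
      apply: (@computable_odd _ M); computable_tac
  | |- computable _ (fun p xs => nat_of_bool (bit (@?M p xs) (@?N p xs))) =>
      apply: (@computable_bit _ M N); computable_tac
  | |- computable _ (fun p xs => nat_of_bool
        (all (fun i => @?b p i xs) (iota 0 (@?N p xs)))) =>
      apply: (@computable_all _ N b); computable_tac
  | |- computable _ (fun p xs => nat_of_bool
        (has (fun i => @?b p i xs) (iota 0 (@?N p xs)))) =>
      apply: (@computable_has _ N b); computable_tac
  | |- computable _ (fun p xs => cantor_pair (@?M p xs) (@?N p xs)) =>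
      apply: (@computable_pair _ M N); computable_tac
  | |- computable _ (fun p xs => unpair1 (@?M p xs)) =>
      apply: (@computable_unpair1 _ M); computable_tac
  | |- computable _ (fun p xs => unpair2 (@?M p xs)) =>
      apply: (@computable_unpair2 _ M); computable_tac
  | |- computable _ (fun p xs =>
        match @?b p xs with true => @?M p xs | false => @?N p xs end) =>
      apply: (@computable_if _ b M N); computable_tac
  | |- computable _ (fun p xs => \sum_(0 <= i < @?N p xs) @?G p i xs) =>
      apply: (@computable_sum _ N G); computable_tac
  | |- computable _ (fun p xs =>
        iter (@?N p xs) (fun z => @?G p z xs) (@?B p xs)) =>
      apply: (@computable_iter _ N G B); computable_tac
  | |- computable _ (fun p xs => p (@?M p xs)) =>
      apply: (@computable_oracle _ M); computable_tac
  | |- _ => idtac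
  end.


(** * Pairing and finite sets *)

(** Pairs are numbered along the diagonals of constant sum, and each diagonal ends before the next
    one starts. *)
Lemma cantor_pair_lt u v u' v' :
  u + v < u' + v' -> cantor_pair u v < cantor_pair u' v'.
Proof.
move=> lt_uv; rewrite /cantor_pair.
apply: (@leq_trans ('C((u + v).+2, 2))).
  by rewrite [X in _ < X]binS bin1 -addnS leq_add2l ltnS leq_addr.
by apply: leq_trans (leq_addr _ _); apply: leq_bin2l.
Qed.

Lemma cantor_pair_inj u v u' v' :
  cantor_pair u v = cantor_pair u' v' -> u = u' /\ v = v'.
Proof.
move=> E.
case: (ltngtP (u + v) (u' + v')) => [/cantor_pair_lt|/cantor_pair_lt|s].
- by rewrite E ltnn.
- by rewrite E ltnn.
move: E; rewrite /cantor_pair s => /addnI eu; split=> //.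
by move: s; rewrite eu => /addnI.
Qed.

Lemma cantor_pair_geq u v : u + v <= cantor_pair u v.
Proof.
by rewrite /cantor_pair binS bin1 -addnA addnCA leq_addr.
Qed.

Lemma cantor_pair_surj z : exists u v, z = cantor_pair u v.
Proof.
elim: z => [|z [u [[|v] ->]]]; first by exists 0, 0.
  (* The diagonal is exhausted at [(u, 0)]; the next one starts at [(0, u.+1)]. *)
  exists 0, u.+1; rewrite /cantor_pair addn0 add0n [in RHS]binS bin1 addn0.
  by rewrite addnS.
by exists u.+1, v; rewrite /cantor_pair !addnS addSn.
Qed.

Lemma unpairK h u v : unpair h (cantor_pair u v) = h u v.
Proof.
have uP : u < (cantor_pair u v).+1.
  by rewrite ltnS (leq_trans _ (cantor_pair_geq u v)) // leq_addr.
have vP : v < (cantor_pair u v).+1.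
  by rewrite ltnS (leq_trans _ (cantor_pair_geq u v)) // leq_addl.
have inj u' v' : cantor_pair u' v' == cantor_pair u v = (u' == u) && (v' == v).
  apply/eqP/andP => [/cantor_pair_inj [-> ->]|[/eqP -> /eqP ->]] //.
rewrite /unpair (bigD1_seq u) ?iota_uniq ?mem_index_iota //=.
rewrite (bigD1_seq v) ?iota_uniq ?mem_index_iota //= !big1.
- by rewrite inj !eqxx muln1 !addn0.
- by move=> i iu; rewrite big1 // => j _; rewrite inj (negPf iu) muln0.
- by move=> j jv; rewrite inj (negPf jv) andbF muln0.
Qed.

Lemma unpair1K u v : unpair1 (cantor_pair u v) = u.
Proof. exact: unpairK. Qed.

Lemma unpair2K u v : unpair2 (cantor_pair u v) = v.
Proof. exact: unpairK. Qed.

Lemma pair_unpair z : cantor_pair (unpair1 z) (unpair2 z) = z.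
Proof.
by have [u [v ->]] := cantor_pair_surj z; rewrite unpair1K unpair2K.
Qed.

(** * Binary digits and canonical indices of finite sets *)

Definition bits (x : nat) : {fset nat} := [fset i in iota 0 x | bit x i]%fset.

Lemma bitS x i : bit x i.+1 = bit x./2 i.
Proof. by rewrite /bit iterSr. Qed.

Lemma bit_sum (b : nat -> bool) n j :
  bit (\sum_(0 <= i < n) b i * 2 ^ i) j = (j < n) && b j.
Proof.
elim: n b j => [|n IH] b j.
  by rewrite big_geq // /bit; elim: j => //= j; rewrite -iterS iterSr.
have -> : \sum_(0 <= i < n.+1) b i * 2 ^ i =
    b 0 + (\sum_(0 <= i < n) b i.+1 * 2 ^ i).*2.
  rewrite big_nat_recl // muln1 -mul2n big_distrr /=; congr (_ + _).
  by apply: eq_bigr => i _; rewrite expnS mulnCA.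
case: j => [|j]; first by rewrite /bit /= oddD odd_double addbF; case: (b 0).
by rewrite bitS half_bit_double IH.
Qed.

Lemma sum_bit x n : x < 2 ^ n -> \sum_(0 <= i < n) bit x i * 2 ^ i = x.
Proof.
elim: n x => [|n IH] x; first by rewrite big_geq //; case: x.
move=> xlt; rewrite big_nat_recl // muln1 -[RHS]odd_double_half; congr (_ + _).
rewrite -[X in X.*2](IH x./2); last first.
  by rewrite ltn_half_double -mul2n -expnS.
rewrite -mul2n big_distrr /=.
by apply: eq_bigr => i _; rewrite expnS mulnCA bitS.
Qed.

Lemma bit_lt x i : bit x i -> i < x.
Proof.
have xlt : x < 2 ^ x by exact: ltn_expl.
by rewrite -{1}(sum_bit xlt) bit_sum => /andP[].
Qed.

Lemma in_bits x i : (i \in bits x) = bit x i.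
Proof.
rewrite !inE mem_iota /= add0n; apply/andP/idP => [[]//|xi].
by rewrite (bit_lt xi).
Qed.

Lemma fset_indexE (X : {fset nat}) n : (forall i, i \in X -> i < n) ->
  fset_index X = \sum_(0 <= i < n) (i \in X) * 2 ^ i.
Proof.
move=> Xn; rewrite /fset_index.
transitivity (\sum_(0 <= i < n | i \in X) 2 ^ i).
  rewrite -[in RHS]big_filter; apply: perm_big; apply: uniq_perm => //.
    by rewrite filter_uniq ?iota_uniq.
  move=> i; rewrite mem_filter mem_index_iota /=.
  by case: (boolP (i \in X)) => // /Xn.
by rewrite big_mkcond; apply: eq_bigr => i _; case: (i \in X); rewrite ?mul1n.
Qed.

Lemma bit_fset_index (X : {fset nat}) i : bit (fset_index X) i = (i \in X).
Proof.
have Xn j : j \in X -> j < (\max_(k <- X) k).+1.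
  by move=> jX; rewrite ltnS; apply: leq_bigmax_seq.
rewrite (fset_indexE Xn) bit_sum.
by case: (boolP (i \in X)) => [/Xn ->|]//; rewrite andbF.
Qed.

Lemma fset_indexK : cancel fset_index bits.
Proof. by move=> X; apply/fsetP => i; rewrite in_bits bit_fset_index. Qed.

Lemma bitsK : cancel bits fset_index.
Proof.
move=> x; rewrite (@fset_indexE _ x); last first.
  by move=> i; rewrite in_bits; exact: bit_lt.
rewrite -[RHS](sum_bit (ltn_expl x (ltnSn 1))).
by apply: eq_bigr => i _; rewrite in_bits.
Qed.

(** Puts the cardinality into a form that a program can evaluate on the index. *)
Lemma card_bits x : #|` bits x| = \sum_(0 <= i < x) bit x i.
Proof.
have -> : #|` bits x| = \sum_(i <- bits x) 1 by rewrite sum1_size.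
rewrite (perm_big [seq i <- iota 0 x | bit x i]) /=; last first.
  apply: uniq_perm => [||i]; first exact: fset_uniq.
    by rewrite filter_uniq ?iota_uniq.
  rewrite in_bits mem_filter mem_iota /= add0n.
  by case: (boolP (bit x i)) => // /bit_lt.
rewrite big_filter big_mkcond /index_iota subn0.
by apply: eq_bigr => i _; case: bit.
Qed.

(** * Bases by closed choice *)

Lemma computes_computable F : computable 1 F ->
  exists c, forall p, computes c p (fun k => F p [:: k]).
Proof. by move=> [c cF]; exists c => p k; exact: cF. Qed.

Lemma set_name_neq0 p A x : set_name p A -> (p x != 0) = (x \in A).
Proof. by move=> ->; case: (x \in A). Qed.

Lemma range_dep N (Y : {fset nat}) : [set` Y] `<=` ground N ->
  (exists k, [set` dep N k] `<=` [set` Y]) -> range (dep N) Y.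
Proof.
move=> YM [k kY]; apply: dep_up => //; exists k.
by apply/fsubsetP => x; exact: kY.
Qed.

(** If [X] with one more element were independent, it would be larger than [B], and exchange would
    extend [B] to a larger independent set, against the maximality of [B]. *)
Lemma basis_of_card N (X B : {fset nat}) :
  basis N [set` B] -> #|` X| = #|` B| -> [set` X] `<=` ground N ->
  ~ range (dep N) X -> basis N [set` X].
Proof.
move=> [BM Bind Bmax] XB XM Xind; split=> // [k kX|x [xM xX]].
  by apply/Xind/range_dep => //; exists k.
have xXM : [set` (x |` X)%fset] `<=` ground N.
  by move=> y /=; rewrite !inE => /orP[/eqP ->//|/XM].
suff [k _ kE] : range (dep N) (x |` X)%fset.
  by exists k => y /=; rewrite kE !inE => /orP[/eqP ->|]; [right|left].
apply: contrapT => xXind.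
have BnD : ~ range (dep N) B by move=> [k _ kB]; apply: (Bind k); rewrite kB.
have lt : #|` B| < #|` (x |` X)%fset| .
  by rewrite cardfsU1 -XB; move/negP: xX => /= ->.
have [y [yX yB yind]] := dep_exchange BM xXM lt BnD xXind.
have [|k kB] := Bmax y; first by split; [exact: xXM|exact/negP].
apply: yind; apply: range_dep; last first.
  by exists k => z /kB /= [|->]; rewrite !inE ?eqxx // => ->; rewrite orbT.
by move=> z /=; rewrite !inE => /orP[/eqP ->|/BM//]; apply: xXM.
Qed.

(** [z] pairs a candidate index with a stage. A candidate is output when it fails a test at that
    stage. The default 0 is the index of the empty set, which has the wrong size when [n] is
    positive. *)
Definition bad_index (n : nat) (p : baire) (z : nat) : nat :=
  if (((\sum_(0 <= i < unpair1 z) bit (unpair1 z) i) == n)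
      && all (fun i => ~~ bit (unpair1 z) i || (p i.*2 != 0))
           (iota 0 (unpair1 z)))
      && (p (unpair2 z).*2.+1 != unpair1 z)
  then 0 else unpair1 z.

Lemma computable_bad_index n :
  computable 1 (fun p xs => bad_index n p (nth 0 xs 0)).
Proof. by rewrite /bad_index; computable_tac. Qed.

Lemma bad_indexP n p N m : 0 < n -> ematroid_name p N ->
  ~ range (bad_index n p) m <->
  [/\ #|` bits m| = n, [set` bits m] `<=` ground N &
      ~ range (dep N) (bits m)].
Proof.
move=> n_gt0 [gN dN].
have grd x : all (fun i => ~~ bit x i || (p i.*2 != 0)) (iota 0 x) <->
    [set` bits x] `<=` ground N.
  split=> [/allP H i /=|H].
    rewrite in_bits => xi; have := H i; rewrite mem_iota add0n /= bit_lt // xi.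
    by rewrite (set_name_neq0 i gN) => /(_ isT) /set_mem.
  apply/allP => i _; case: (boolP (bit x i)) => //= xi.
  rewrite (set_name_neq0 i gN); apply/mem_set/H => /=.
  by rewrite in_bits.
split=> [mP|[mn mM mD] [z _]].
  have := mP; rewrite /bad_index.
  (* If [m] failed a test at stage [j], it would be the value at [<m, j>]. *)
  have bad j : [/\ #|` bits m| = n, [set` bits m] `<=` ground N &
      dep N j != bits m].
    apply: contrapT => H; apply: mP; exists (cantor_pair m j) => //.
    rewrite /bad_index unpair1K unpair2K ifN //; apply/negP.
    move=> /andP[/andP[/eqP c /grd g] d]; apply: H; split=> //.
      by rewrite card_bits.
    by apply: contraNneq d => d; rewrite -[_ j.*2.+1]/(odd_part p j) dN d bitsK.
  have [mn mM _] := bad 0; split=> // -[j _ jm].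
  by have [_ _] := bad j; rewrite jm eqxx.
rewrite /bad_index; case: ifPn => [/andP[/andP[_ _] _]|].
  by move=> m0; move: mn n_gt0; rewrite card_bits -m0 big_geq // => <-.
move=> H zm; apply/negP : H; rewrite negbK zm -card_bits mn eqxx /=.
apply/andP; split; first exact/grd.
apply/eqP => d; apply: mD; exists (unpair2 z) => //.
by rewrite -d -[p _]/(odd_part p (unpair2 z)) dN fset_indexK.
Qed.

Lemma EMB_reducible_C_N n : 0 < n -> sW_reducible (EMB n) C_N.
Proof.
move=> n_gt0.
have [Phi PhiP] := computes_computable (computable_bad_index n).
(* The binary digits of a canonical index are the characteristic function of the set. *)
have [Psi PsiP] : exists c, forall p, computes c p (fun k => bit (p 0) k).
  apply: (computes_computable (F := fun p xs => bit (p 0) (nth 0 xs 0))).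
  by computable_tac.
exists Phi, Psi => p N pN [B [Bbasis Bn]].
have finB : finite_set B by exists n.
move: Bbasis Bn; rewrite -(fset_setK finB); set X := fset_set B.
move=> Xbasis /card_eq_fsetP Xn.
exists (bad_index n p), (bad_index n p); split=> //.
  (* The index of the given basis is missed, so this is an instance of closed choice. *)
  exists (fset_index X); apply/(bad_indexP _ n_gt0 pN); rewrite fset_indexK.
  case: Xbasis => XM Xind _; split=> // -[k _ kX].
  by apply: (Xind k); rewrite kX.
move=> r m <- /(bad_indexP _ n_gt0 pN) [rn rM rD].
exists (fun k => bit (r 0) k), [set` bits (r 0)]; split=> //.
  by move=> x; congr nat_of_bool; apply/idP/idP => [xr|/set_mem /=];
    [apply/mem_set|]; rewrite /= in_bits.
by apply: basis_of_card Xbasis _ rM rD; rewrite rn Xn.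
Qed.

(** * Maximal antichains as bases *)

Lemma joined_refl G u : joined G u u.
Proof. by exists [::]. Qed.

Lemma joined_trans G u v w : joined G u v -> joined G v w -> joined G u w.
Proof.
move=> [s [us sv]] [t [vt tw]]; exists (s ++ t).
by rewrite cat_path last_cat us sv.
Qed.

Lemma joined_edge G u v : edges G (u, v) -> joined G u v.
Proof.
by move=> uv; exists [:: v]; rewrite /= andbT; split=> //; apply/mem_set.
Qed.

Lemma joined_ind G (P : nat -> nat -> Prop) : (forall u, P u u) ->
  (forall u v w, edges G (u, v) -> joined G v w -> P v w -> P u w) ->
  forall u v, joined G u v -> P u v.
Proof.
move=> P0 PS u v [s []]; elim: s u => [|x s IH] u /=; first by move=> _ <-.
move=> /andP[/set_mem ux xs] sv.
by apply: PS ux _ (IH _ xs sv); exists s.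
Qed.

Lemma joined_sym G u v : joined G u v -> joined G v u.
Proof.
elim/joined_ind => [{}u|{}u {}v w uv _ wv]; first exact: joined_refl.
exact/(joined_trans wv)/joined_edge/edges_sym.
Qed.

(** A numbering of the components carried by the vertices, in place of a bijection defined on sets
    of vertices. *)
Definition labelling (G : graph) (n : nat) (lab : nat -> nat) : Prop :=
  [/\ forall u v, vertices G u -> vertices G v ->
        joined G u v <-> lab u = lab v,
      forall v, vertices G v -> lab v < n &
      forall i, i < n -> exists2 v, vertices G v & lab v = i].

Lemma labelling_repr G n lab : labelling G n lab ->
  exists r : nat -> nat, forall i, i < n -> vertices G (r i) /\ lab (r i) = i.
Proof.
move=> [_ _ labS]; suff /choice [r rP] : forall i, exists v, i < n ->
  vertices G v /\ lab v = i by exists r.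
by move=> i; case: (ltnP i n) => [/labS [v Gv <-]|_]; [exists v|exists 0].
Qed.

Lemma component_eq G u v : component G u = component G v <-> joined G u v.
Proof.
split=> [E|uv].
  by have : component G v v := joined_refl G v; rewrite -E.
apply/seteqP; split=> w; last exact: joined_trans.
exact/joined_trans/joined_sym.
Qed.

Lemma card_componentsP G n :
  components G #= `I_n <-> exists lab, labelling G n lab.
Proof.
split=> [/card_set_bijP [g [gfun ginj gsurj]]|[lab labP]].
  exists (fun v => g (component G v)); split.
  - move=> u v Gu Gv; rewrite -component_eq; split=> [->//|/ginj]; apply.
      by apply/mem_set; exists u.
    by apply/mem_set; exists v.
  - by move=> v Gv; apply: gfun; exists v.
  - by move=> i /gsurj [_ [v Gv <-] <-]; exists v.
have [r rP] := labelling_repr labP; have [labJ labn labS] := labP.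
rewrite (_ : components G = (fun i => component G (r i)) @` `I_n).
  apply: inj_card_eq => i j /set_mem /rP [Gi Ei] /set_mem /rP [Gj Ej].
  by move=> /component_eq J; rewrite -Ei -Ej; apply/labJ.
apply/seteqP; split=> [_ [v Gv <-]|_ [i /rP [Gi _] <-]]; last by exists (r i).
exists (lab v); first exact: labn.
have [Gr ErE] := rP _ (labn _ Gv).
by apply/component_eq/labJ.
Qed.

(* The state [<u, <a, rest>>] stands for the current vertex [u] and the list of
   vertices to visit. Illegal moves are skipped, so that the vertex reached is
   always joined to the initial one, whatever the list is. *)
Definition walk_step (e : nat -> nat -> bool) (st : nat) : nat :=
  cantor_pair
    (if e (unpair1 st) (unpair1 (unpair2 st)) then unpair1 (unpair2 st)
     else unpair1 st)
    (unpair2 (unpair2 st)).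

Lemma walk_joined G (e : nat -> nat -> bool) t st :
  (forall u v, e u v -> edges G (u, v)) ->
  joined G (unpair1 st) (unpair1 (iter t (walk_step e) st)).
Proof.
move=> eG; elim: t => [|t IH]; first exact: joined_refl.
apply: joined_trans IH _; rewrite iterS; move: (iter _ _ _) => {}st.
rewrite unpair1K; case: ifP => [/eG|_]; [exact: joined_edge|exact: joined_refl].
Qed.

(** The list is built from its end: a first edge to a new vertex puts that vertex in front of the
    list for the remaining walk. *)
Lemma joined_walk G (e : nat -> nat -> bool) u v :
  (forall u v, edges G (u, v) -> e u v) ->
  joined G u v ->
  exists t rest, unpair1 (iter t (walk_step e) (cantor_pair u rest)) = v.
Proof.
move=> eG; elim/joined_ind => [{}u|{}u {}v w /eG uv _ [t [rest IH]]].
  by exists 0, 0; rewrite unpair1K.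
exists t.+1, (cantor_pair v rest).
by rewrite iterSr /walk_step !unpair1K !unpair2K unpair1K uv.
Qed.

Definition name_vertex (p : baire) (v : nat) : bool := p v.*2 != 0.

Definition name_edge (p : baire) (u v : nat) : bool :=
  p (cantor_pair u v).*2.+1 != 0.

Lemma name_vertexE p G v : graph_name p G -> name_vertex p v <-> vertices G v.
Proof.
move=> [pV _]; rewrite /name_vertex (set_name_neq0 v pV).
by split=> [/set_mem|/mem_set].
Qed.

Lemma name_edgeE p G u v : graph_name p G -> name_edge p u v <-> edges G (u, v).
Proof.
move=> [_ pE]; rewrite /name_edge -[p _]/(odd_part p (cantor_pair u v)) pE.
by case: (boolP (_ \in _)) => [/set_mem|/negP nuv]; split=> // /mem_set.
Qed.

(* The matroid of a graph: the vertex [v] becomes the element [v.+1], two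
   joined vertices are parallel, and the additional element 0 is a loop, which
   ensures that there is a dependent set even if the graph has no edge. *)
Definition graph_ground (G : graph) : set nat :=
  [set y | y == 0 \/ vertices G y.-1].

Definition graph_dependent (G : graph) (B : set nat) : Prop :=
  B 0 \/ exists u v, [/\ B u.+1, B v.+1, u <> v & joined G u v].

(* [k] codes a finite set [x] together with a walk that witnesses its
   dependence; the set coded by 1 is the loop [{0}]. *)
Definition graph_dep_index (p : baire) (k : nat) : nat :=
  if all (fun y => ~~ bit (unpair1 k) y || ((y == 0) || (p y.-1.*2 != 0)))
       (iota 0 (unpair1 k)) &&
     (bit (unpair1 k) 0 ||
      ((bit (unpair1 k) (unpair1 (unpair2 (unpair2 k))).+1 &&
        bit (unpair1 k) (unpair1 (iter (unpair1 (unpair2 k))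
          (walk_step (name_edge p)) (unpair2 (unpair2 k)))).+1) &&
        (unpair1 (unpair2 (unpair2 k)) !=
         unpair1 (iter (unpair1 (unpair2 k))
           (walk_step (name_edge p)) (unpair2 (unpair2 k))))))
  then unpair1 k else 1.

Definition graph_dep (p : baire) (k : nat) : {fset nat} :=
  bits (graph_dep_index p k).

Lemma computable_graph_dep_index a M : computable a M ->
  computable a (fun p xs => graph_dep_index p (M p xs)).
Proof.
apply: computable_app.
by rewrite /graph_dep_index /walk_step /name_edge; computable_tac.
Qed.

Lemma graph_dependentS G (A B : set nat) : A `<=` B ->
  graph_dependent G A -> graph_dependent G B.
Proof.
move=> AB [/AB|[u [v [/AB Bu /AB Bv uv J]]]]; first by left.
by right; exists u, v.
Qed.

Lemma bits1 : bits 1 = [fset 0]%fset.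
Proof.
by rewrite -[RHS]fset_indexK /fset_index big_seq_fset1.
Qed.

Lemma all_groundP p G x : graph_name p G ->
  all (fun y => ~~ bit x y || ((y == 0) || (p y.-1.*2 != 0))) (iota 0 x) <->
  [set` bits x] `<=` graph_ground G.
Proof.
move=> pG; split=> [/allP H y /=|H].
  rewrite in_bits => xy; have := H y; rewrite mem_iota add0n /= bit_lt // xy.
  move=> /(_ isT) /= /orP[|/(name_vertexE _ pG)]; [by left|by right].
apply/allP => y _; case: (boolP (bit x y)) => //= xy.
have /H [->//|/(name_vertexE _ pG) yV] : [set` bits x] y.
  by rewrite /= in_bits.
by rewrite -[p _ != 0]/(name_vertex p y.-1) yV orbT.
Qed.

Lemma graph_depP p G k : graph_name p G ->
  [set` graph_dep p k] `<=` graph_ground G /\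
  graph_dependent G [set` graph_dep p k].
Proof.
move=> pG; rewrite /graph_dep /graph_dep_index.
case: ifPn => [/andP[/(all_groundP _ pG) xM D]|_]; last first.
  by rewrite bits1; split=> [y /=|]; [rewrite !inE; left|left; rewrite /= !inE].
split=> //; case/orP: D => [x0|/andP[/andP[xi xj] /eqP ij]].
  by left; rewrite /= in_bits.
right; exists (unpair1 (unpair2 (unpair2 k))),
  (unpair1 (iter (unpair1 (unpair2 k)) (walk_step (name_edge p))
    (unpair2 (unpair2 k)))).
rewrite /= !in_bits; split=> //.
by apply: walk_joined => u v /(name_edgeE _ _ pG).
Qed.

Lemma range_graph_dep p G (Y : {fset nat}) : graph_name p G ->
  [set` Y] `<=` graph_ground G ->
  range (graph_dep p) Y <-> graph_dependent G [set` Y].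
Proof.
move=> pG YM; split=> [[k _ <-]|D]; first by have [] := graph_depP k pG.
suff [w wP] : exists w,
    graph_dep_index p (cantor_pair (fset_index Y) w) = fset_index Y.
  by exists (cantor_pair (fset_index Y) w); rewrite // /graph_dep wP fset_indexK.
case: D => [/= Y0|[u [v [/= Yu Yv uv]]]].
  exists 0; rewrite /graph_dep_index unpair1K bit_fset_index Y0 andbT ifT //.
  by apply/(all_groundP _ pG); rewrite fset_indexK.
move=> /(@joined_walk _ (name_edge p)) [|t [rest wP]].
  by move=> ? ? /(name_edgeE _ _ pG).
(* With the index of [Y] in front, this gives the set, the number of steps and the initial state of
   the walk. *)
exists (cantor_pair t (cantor_pair u rest)).
rewrite /graph_dep_index !unpair1K !unpair2K !unpair1K wP !bit_fset_index Yu Yv.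
rewrite (introN eqP uv) orbT andbT ifT //.
by apply/(all_groundP _ pG); rewrite fset_indexK.
Qed.

(** Distinct elements with equal labels would be parallel. The loop 0, whose truncated predecessor
    collides with that of 1, does not occur in an independent set. *)
Lemma graph_independent_card G n lab (X : {fset nat}) : labelling G n lab ->
  [set` X] `<=` graph_ground G -> ~ graph_dependent G [set` X] ->
  #|` ((fun y => lab y.-1) @` X)%fset| = #|` X|.
Proof.
move=> [labJ _ _] XM Xind; apply/eqP/card_in_imfsetP => -[|x] [|y] Xx Xy //=.
- by move=> _; case: Xind; left.
- by move=> _; case: Xind; left.
move=> xy; have [//|Gx] := XM _ Xx; have [//|Gy] := XM _ Xy.
congr _.+1; apply: contrapT => nxy; apply: Xind; right; exists x, y.
by split=> //; apply/labJ.
Qed.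

(** Labels are injective on independent sets, so [Y] shows more labels than [X]. An element of [Y]
    whose label is missing in [X] is parallel to nothing in [X]. *)
Lemma graph_exchange G n lab (X Y : {fset nat}) : labelling G n lab ->
  [set` X] `<=` graph_ground G -> [set` Y] `<=` graph_ground G ->
  #|` X| < #|` Y| ->
  ~ graph_dependent G [set` X] -> ~ graph_dependent G [set` Y] ->
  exists y : nat, [/\ y \in Y, y \notin X &
    ~ graph_dependent G [set` (y |` X)%fset]].
Proof.
move=> labP XM YM XY Xind Yind; have [labJ _ _] := labP.
have labYX : ~~ ((fun y => lab y.-1) @` Y `<=` (fun y => lab y.-1) @` X)%fset.
  apply: contraL XY => /fsubset_leq_card; rewrite -leqNgt.
  by rewrite !(graph_independent_card labP).
have [_ /imfsetP [y /= Yy ->] yX] := fsubsetPn _ _ labYX.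
have labyX x : x \in X -> lab x.-1 <> lab y.-1.
  move=> xX E; move/negP: yX; apply; rewrite -E.
  exact: (in_imfset _ (fun y => lab y.-1)).
exists y; split=> //; first by apply/negP => /labyX.
have [y0|Gy] := YM _ Yy; first by case: Yind; left; rewrite /= -(eqP y0).
have XG x : x.+1 \in X -> vertices G x by move=> /XM [].
case=> [|[u [v [/=]]]]; rewrite /= !inE.
  move=> /orP[/eqP y0|X0]; last by apply: Xind; left.
  by apply: Yind; left; rewrite /= y0.
(* If both elements are [y], then [u = v]; if exactly one is, the label of [y] occurs in [X]; if
   none is, [X] itself is dependent. *)
move=> /orP[/eqP uy|Xu] /orP[/eqP vy|Xv] uv J.
- by apply: uv; move: uy; rewrite -vy => -[].
- apply: (labyX _ Xv); rewrite -uy /=; apply/esym/labJ => //; last exact: XG.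
  by rewrite -[u]/u.+1.-1 uy.
- apply: (labyX _ Xu); rewrite -vy /=; apply/labJ => //; first exact: XG.
  by rewrite -[v]/v.+1.-1 vy.
- by apply: Xind; right; exists u, v.
Qed.

Lemma graph_ematroid p G n lab : graph_name p G -> labelling G n lab ->
  exists N, ground N = graph_ground G /\ dep N = graph_dep p.
Proof.
move=> pG labP.
have depM k : [set` graph_dep p k] `<=` graph_ground G.
  by have [] := graph_depP k pG.
have dep0 k : graph_dep p k <> fset0.
  by have [_] := graph_depP k pG; move=> + E; rewrite E => -[|[? [? []]]].
have depU (Y : {fset nat}) : [set` Y] `<=` graph_ground G ->
    (exists k, (graph_dep p k `<=` Y)%fset) -> range (graph_dep p) Y.
  move=> YM [k /fsubsetP kY]; apply/(range_graph_dep pG) => //.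
  by apply: graph_dependentS kY _; have [] := graph_depP k pG.
suff ex (X Y : {fset nat}) :
    [set` X] `<=` graph_ground G -> [set` Y] `<=` graph_ground G ->
    #|` X| < #|` Y| ->
    ~ range (graph_dep p) X -> ~ range (graph_dep p) Y ->
    exists y : nat, [/\ y \in Y, y \notin X &
      ~ range (graph_dep p) (y |` X)%fset].
  by exists (EMatroid depM dep0 depU ex).
move=> XM YM XY; rewrite !(range_graph_dep pG) // => Xind Yind.
have [y [Yy Xy yind]] := graph_exchange labP XM YM XY Xind Yind.
exists y; split=> //; rewrite (range_graph_dep pG) // => z /=.
by rewrite !inE => /orP[/eqP ->|/XM//]; apply: YM.
Qed.

Lemma graph_basisP p G N (B : set nat) : graph_name p G ->
  ground N = graph_ground G -> dep N = graph_dep p ->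
  basis N B <-> [/\ B `<=` graph_ground G, ~ graph_dependent G B &
    forall x, graph_ground G x -> ~ B x -> graph_dependent G (B `|` [set x])].
Proof.
move=> pG NM Nd; have depP (A : set nat) : A `<=` graph_ground G ->
    (exists k, [set` dep N k] `<=` A) <-> graph_dependent G A.
  rewrite Nd => AM; split=> [[k kA]|].
    by apply: graph_dependentS kA _; have [] := graph_depP k pG.
  (* [A] may be infinite, but its dependence is already that of the loop or of a pair of parallel
     elements. *)
  suff fin (Y : {fset nat}) : [set` Y] `<=` A -> graph_dependent G [set` Y] ->
      exists k, [set` graph_dep p k] `<=` A.
    case=> [A0|[u [v [Au Av uv J]]]].
      apply: (fin [fset 0]%fset) => [x /=|]; first by rewrite !inE => /eqP ->.
      by left; rewrite /= !inE.
    apply: (fin [fset u.+1; v.+1]%fset) => [x /=|].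
      by rewrite !inE => /orP[] /eqP ->.
    by right; exists u, v; split=> //=; rewrite !inE eqxx ?orbT.
  move=> YA YD; have [k _ kY] : range (graph_dep p) Y.
    by apply/(range_graph_dep pG) => //; exact: subset_trans AM.
  by exists k; rewrite kY.
split=> [[BM Bind Bmax]|[BM Bind Bmax]]; split; rewrite ?NM // -?NM //.
- by move=> /depP -[|k]; [rewrite -NM|exact: Bind].
- move=> x xM xB; apply/depP; last exact: Bmax.
  by move=> y [/BM|->]; rewrite -NM.
- by move=> k kB; apply/Bind/depP => //; exists k.
- move=> x; rewrite NM => -[xM xB]; apply/depP; last exact: Bmax.
  by move=> y [/BM|->].
Qed.

Lemma GAC_reducible_EMB n : sW_reducible (GAC n) (EMB n).
Proof.
have [Phi PhiP] : exists c, forall p, computes c p (fun k =>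
    if odd k then graph_dep_index p k./2
    else ((k./2 == 0) || (p k./2.-1.*2 != 0))).
  apply: (computes_computable (F := fun p xs => if odd (nth 0 xs 0)
    then graph_dep_index p (nth 0 xs 0)./2
    else ((nth 0 xs 0)./2 == 0) || (p (nth 0 xs 0)./2.-1.*2 != 0))).
  computable_tac; apply: computable_graph_dep_index; computable_tac.
have [Psi PsiP] : exists c, forall p, computes c p (fun k => p k.+1).
  apply: (computes_computable (F := fun p xs => p (nth 0 xs 0).+1)).
  by computable_tac.
exists Phi, Psi => p G pG /card_componentsP [lab labP].
have [N [NM Nd]] := graph_ematroid pG labP.
have [labJ labn labS] := labP; have [r rP] := labelling_repr labP.
eexists _, N; split; first exact: PhiP.
- split=> [x|k].
    rewrite /even_part odd_double doubleK NM; congr nat_of_bool.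
    apply/orP/idP => [xM|/set_mem [->|/(name_vertexE _ pG)]]; last first.
    + by right.
    + by left.
    by apply/mem_set; case: xM => [|/(name_vertexE _ pG)]; [left|right].
  by rewrite /odd_part /= odd_double /= uphalf_double Nd bitsK.
(* One representative of each component, shifted, forms a basis of size [n]. *)
- exists ((fun i => (r i).+1) @` `I_n); split; last first.
    apply: inj_card_eq => i j /set_mem /rP [_ Ei] /set_mem /rP [_ Ej].
    by move=> [Eij]; rewrite -Ei Eij.
  apply/(graph_basisP _ pG NM Nd); split=> [_ [i /rP [Gi _] <-]||x].
  + by right.
  + case=> [[//]|[u [v [[i iP [<-]] [j jP [<-]] ij J]]]].
    have [Gi Ei] := rP _ iP; have [Gj Ej] := rP _ jP.
    by apply: ij; congr r; rewrite -Ei -Ej; apply/labJ.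
  + case=> [/eqP -> _|]; first by left; right.
    case: x => [|x] /= Gx xB; first by left; right.
    have [Gr Er] := rP _ (labn _ Gx).
    right; exists x, (r (lab x)); split; last by apply/labJ.
    * by right.
    * by left; exists (lab x) => //; exact: labn.
    * by move=> E; apply: xB; exists (lab x); [exact: labn|rewrite -E].
move=> s B sB /(graph_basisP _ pG NM Nd) [BM Bind Bmax].
exists (fun k => s k.+1), [set v | B v.+1]; split=> //.
split; first split.
- by move=> v /BM [].
- by move=> u v Bu Bv uv J; apply: Bind; right; exists u, v.
move=> C [CG Cind] BC; apply/seteqP; split=> [v Cv|v Bv]; last exact: BC.
(* Otherwise adding [v.+1] to [B] creates a dependence, which yields two distinct joined vertices
   inside the antichain [C]. *)
apply: contrapT => Bv.
have [|[B0|//]|[u [w [Bu Bw uw J]]]] := Bmax v.+1 _ Bv.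
- by right; exact: CG.
- by apply: Bind; left.
by apply: (Cind u w) => //; [case: Bu => [/BC|[->]]|case: Bw => [/BC|[->]]].
Qed.

(** * Closed choice by maximal antichains *)

(** A vertex whose label is not met by [A] could be added to [A], against maximality. *)
Lemma maximal_antichainP G n lab A : labelling G n lab ->
  maximal_antichain G A ->
  [/\ A `<=` vertices G,
      {in A &, injective lab} &
      forall i, i < n -> exists2 a, A a & lab a = i].
Proof.
move=> [labJ labn labS] [[AG Aanti] Amax]; split=> //.
  move=> u v /set_mem Au /set_mem Av E; apply: contrapT => uv.
  by apply: (Aanti u v Au Av uv); apply/labJ => //; exact: AG.
move=> i /labS [v Gv <-]; apply: contrapT => nA.
have vA a : A a -> ~ joined G a v.
  by move=> Aa J; apply: nA; exists a => //; apply/labJ => //; exact: AG.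
have Av : A v.
  rewrite -(Amax (A `|` [set v])); [by right| |by move=> x; left].
  split=> [x [/AG//|->//]|x y [Ax|->] [Ay|->] xy //].
  - exact: Aanti.
  - exact: vA.
  - by move=> /joined_sym; exact: vA.
by apply: (vA v Av); exact: joined_refl.
Qed.

Definition seen (f : nat -> nat) (s j : nat) : bool :=
  has (fun i => f i == j) (iota 0 s).

Lemma seenP f s j : reflect (exists2 i, i < s & f i = j) (seen f s j).
Proof.
apply: (iffP hasP) => [[i]|[i si <-]].
  by rewrite mem_iota => si /eqP <-; exists i.
by exists i; rewrite ?mem_iota.
Qed.

(* The vertices [<i, 0>] with [i < n.-1] lie in different components. The
   vertex [<s, m.+1>] records the guess that [m] is the least number outside
   the range of [f]: all smaller numbers have been seen at stage [s]. A guess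
   that turns out to be wrong is joined to the vertex [0 = <0, 0>]. *)
Definition guess_vertex (n : nat) (f : nat -> nat) (v : nat) : bool :=
  ((unpair2 v == 0) && (unpair1 v < n.-1)) ||
  ((0 < unpair2 v) &&
   all (fun j => seen f (unpair1 v) j) (iota 0 (unpair2 v).-1)).

Definition refuted (f : nat -> nat) (v : nat) : bool :=
  (0 < unpair2 v) && seen f (unpair1 v) (unpair2 v).-1.

(** Requiring a positive second component keeps the vertices [<i, 0>] apart, although their second
    components agree. *)
Definition guess_edge (n : nat) (f : nat -> nat) (u v : nat) : bool :=
  (guess_vertex n f u && guess_vertex n f v) &&
  ((((unpair2 u == unpair2 v) && (0 < unpair2 u)) && (u != v)) ||
   (((u == 0) && refuted f v) || ((v == 0) && refuted f u))).

Lemma unpair1_0 : unpair1 0 = 0. Proof. exact: (unpair1K 0 0). Qed.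

Lemma unpair2_0 : unpair2 0 = 0. Proof. exact: (unpair2K 0 0). Qed.

Lemma guess_edge_vertices n f u v :
  guess_edge n f u v -> guess_vertex n f u /\ guess_vertex n f v.
Proof. by move=> /andP[/andP[]]. Qed.

Lemma guess_edge_sym n f u v : guess_edge n f u v -> guess_edge n f v u.
Proof.
rewrite /guess_edge [guess_vertex n f v && _]andbC => /andP[-> /=].
rewrite [v == u]eq_sym [unpair2 v == _]eq_sym [(v == 0) && _ || _]orbC.
by case/orP => [/andP[/andP[/eqP -> ->] ->]|->]; rewrite ?eqxx ?orbT.
Qed.

Lemma guess_edge_irrefl n f u : ~ guess_edge n f u u.
Proof.
move=> /andP[_]; rewrite !eqxx andbF /= orbb => /andP[/eqP ->].
by rewrite /refuted unpair2_0.
Qed.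

Definition guess_graph (n : nat) (f : nat -> nat) : graph := {|
  vertices := [set v | guess_vertex n f v];
  edges := [set uv | guess_edge n f uv.1 uv.2];
  edges_vertices := @guess_edge_vertices n f;
  edges_sym := @guess_edge_sym n f;
  edges_irrefl := @guess_edge_irrefl n f
|}.

(** With [m] the least number outside the range, the correct guesses get the label [n.-1], which no
    vertex [<i, 0>] has, and the wrong ones share the label of the vertex 0. *)
Definition guess_label (n m v : nat) : nat :=
  if unpair2 v == 0 then unpair1 v
  else if (unpair2 v).-1 == m then n.-1 else 0.

(** A guess above [m] would require [m] to have been seen. Hence wrong guesses stay below the right
    one. *)
Lemma guess_vertex_leq n f m v : ~ range f m -> guess_vertex n f v ->
  (unpair2 v).-1 <= m.
Proof.
move=> fm /orP[/andP[/eqP -> _]//|/andP[_ /allP H]].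
rewrite leqNgt; apply/negP => lt_m; apply: fm.
have := H m; rewrite mem_iota => /(_ lt_m) /seenP [i _ <-].
by exists i.
Qed.

Lemma refuted_label n f m v : ~ range f m -> refuted f v ->
  guess_label n m v = 0.
Proof.
move=> fm /andP[v_gt0 /seenP [i _ fi]];
rewrite /guess_label ifN ?(lt0n_neq0 v_gt0) // ifN //.
by apply/eqP => E; apply: fm; exists i; rewrite ?fi.
Qed.

Lemma seen_all f m : (forall j, j < m -> range f j) ->
  exists s, forall t, s <= t -> all (fun j => seen f t j) (iota 0 m).
Proof.
elim: m => [|m IH] fm; first by exists 0.
have [s sP] := IH (fun j jm => fm j (ltnW jm)).
have [i _ fi] := fm m (ltnSn m).
exists (maxn s i.+1) => t; rewrite geq_max => /andP[/sP st it].
rewrite -addn1 iotaD all_cat st /= andbT.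
by apply/seenP; exists i.
Qed.

(** Labels are constant along edges, and each vertex is joined to a fixed representative of its
    label. *)
Lemma guess_labelling n f m : 1 < n -> ~ range f m ->
  (forall j, j < m -> range f j) ->
  labelling (guess_graph n f) n (guess_label n m).
Proof.
move=> n_gt1 fm fltm; set G := guess_graph n f.
have n1_gt0 : 0 < n.-1 by rewrite -subn1 subn_gt0.
have [s sP] := seen_all fltm.
have label0 : guess_label n m 0 = 0 by rewrite /guess_label unpair2_0 unpair1_0.
have edge_label u v : edges G (u, v) -> guess_label n m u = guess_label n m v.
  move=> /andP[_ /orP[/andP[/andP[/eqP uv u_gt0] _]|]].
    by rewrite /guess_label -uv (negPf (lt0n_neq0 u_gt0)).
  by move=> /orP[]/andP[/= /eqP -> /(refuted_label n fm) ->].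
(* At stage [s] all numbers below [m] have been seen, so the last representative is a vertex. *)
pose r l := if l < n.-1 then cantor_pair l 0 else cantor_pair s m.+1.
have rG i : vertices G (r i).
  rewrite /= /r; case: ifP => ini; rewrite /guess_vertex unpair1K unpair2K //=.
    by rewrite ini.
  exact: sP.
have rE i : i < n -> guess_label n m (r i) = i.
  rewrite /r => ini; case: ifPn; rewrite /guess_label unpair1K unpair2K //= eqxx.
  rewrite -leqNgt => le_i; apply/eqP; rewrite eqn_leq le_i -ltnS prednK //.
  exact: ltnW.
have clique u v : guess_vertex n f u -> guess_vertex n f v ->
    0 < unpair2 u -> unpair2 u = unpair2 v -> joined G u v.
  move=> Gu Gv u_gt0 uv; have [->|neq_uv] := eqVneq u v.
    exact: joined_refl.
  apply: joined_edge; rewrite /= /guess_edge Gu Gv /= -uv eqxx u_gt0 /=.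
  by rewrite neq_uv.
have to_r u : vertices G u -> joined G u (r (guess_label n m u)).
  move=> Gu; have /orP[/andP[/eqP u2 u1]|/andP[u2 uall]] := Gu.
    rewrite /guess_label u2 eqxx /r u1 -[X in joined _ X _]pair_unpair u2.
    exact: joined_refl.
  rewrite /guess_label ifN ?lt0n_neq0 //; have [um|um] := eqVneq.
    apply: clique => //; first exact: rG.
    by rewrite /r ltnn unpair2K -um prednK.
  rewrite /r n1_gt0; change (cantor_pair 0 0) with 0.
  have [i _ fi] : range f (unpair2 u).-1.
    by apply: fltm; rewrite ltn_neqAle um (guess_vertex_leq fm Gu).
  (* The same wrong guess at a stage late enough to be refuted: [u] is joined to [w], and [w] to
     0. *)
  pose w := cantor_pair (maxn (unpair1 u) i.+1) (unpair2 u).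
  have Gw : guess_vertex n f w.
    rewrite /guess_vertex unpair1K unpair2K u2 /= (eqn0Ngt (unpair2 u)) u2 /=.
    apply/allP => j /(allP uall) /seenP [k ku <-].
    by apply/seenP; exists k; rewrite // leq_max ku.
  apply: (joined_trans (clique u w Gu Gw u2 _)); first by rewrite unpair2K.
  apply: joined_edge; rewrite /= /guess_edge Gw eqxx /=.
  apply/andP; split.
    by rewrite /guess_vertex unpair2_0 unpair1_0 n1_gt0.
  rewrite /refuted unpair1K unpair2K u2 /=; apply/orP; right; apply/orP; right.
  by apply/seenP; exists i => //; rewrite leq_max ltnSn orbT.
split.
- move=> u v Gu Gv; split=> [|E].
    by elim/joined_ind => // {Gu Gv} u' v' w' /edge_label -> _.
  apply: joined_trans (to_r _ Gu) _; rewrite E.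
  exact/joined_sym/to_r.
- move=> v /orP[/andP[/eqP v2 v1]|/andP[/lt0n_neq0 v2 _]]; rewrite /guess_label.
    by rewrite v2 eqxx (leq_trans v1) // leq_pred.
  by rewrite ifN //; case: ifP => _; [rewrite prednK //|]; exact: ltnW.
- by move=> i iP; exists (r i); [exact: rG|exact: rE].
Qed.

(** * Computing the graph and decoding its antichains *)

Lemma guess_computed n : exists c, forall p, computes c p (fun k =>
  if odd k then nat_of_bool (guess_edge n p (unpair1 k./2) (unpair2 k./2))
  else guess_vertex n p k./2).
Proof.
apply: (computes_computable (F := fun p xs => if odd (nth 0 xs 0)
  then nat_of_bool
    (guess_edge n p (unpair1 (nth 0 xs 0)./2) (unpair2 (nth 0 xs 0)./2))
  else guess_vertex n p (nth 0 xs 0)./2)).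
rewrite /guess_edge /refuted /guess_vertex /seen; computable_tac.
Qed.

(* Below a bound [k] that is large enough for all [n] elements of the antichain
   to be seen, the largest second component is that of the correct guess. *)
Definition missing (n : nat) (r : baire) (k : nat) : nat :=
  n - \sum_(0 <= b < k) r b.

(** A maximum written as a count of the [c] exceeded by some guess. The second component of a
    guessing vertex is the guess plus one, hence [c.+1]. *)
Definition last_guess (r : baire) (k : nat) : nat :=
  \sum_(0 <= c < k) has (fun b => (r b != 0) && (c.+1 < unpair2 b)) (iota 0 k).

Lemma search_last_guess n : exists c, forall r xs k, size xs = 1 ->
  missing n r k = 0 -> (forall i, i < k -> missing n r i <> 0) ->
  reval r c xs (last_guess r k).
Proof.
apply: (@reval_search 1 (fun p ys => missing n p (nth 0 ys 0))
  (fun p ys => last_guess p (nth 0 ys 0))).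
  by rewrite /missing; computable_tac.
by rewrite /last_guess; computable_tac.
Qed.

Lemma sum_mem (r : baire) A k : set_name r A ->
  \sum_(0 <= b < k) r b = size [seq b <- iota 0 k | b \in A].
Proof.
move=> rA; rewrite -sum1_size big_filter [RHS]big_mkcond /index_iota subn0.
by apply: eq_bigr => b _; rewrite rA; case: (b \in A).
Qed.

Lemma missing_eq0 G n lab A r : labelling G n lab -> maximal_antichain G A ->
  set_name r A -> exists k, missing n r k = 0.
Proof.
move=> labP Amax rA; have [AG Ainj Asurj] := maximal_antichainP labP Amax.
have /choice [a aP] : forall i, exists v, i < n -> A v /\ lab v = i.
  move=> i; case: (ltnP i n) => [/Asurj [v Av <-]|_]; [by exists v|by exists 0].
(* Beyond all the chosen members, which are distinct because their labels are, at least [n] members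
   have been seen. *)
exists (\max_(i <- iota 0 n) a i).+1; apply/eqP; rewrite subn_eq0 (sum_mem _ rA).
rewrite -{1}(size_iota 0 n) -(size_map a); apply: uniq_leq_size.
  rewrite map_inj_in_uniq ?iota_uniq // => i j.
  by rewrite !mem_iota => /aP [_ {2}<-] /aP [_ {2}<-] ->.
move=> _ /mapP [i iP ->]; rewrite mem_filter mem_iota /= ltnS.
rewrite leq_bigmax_seq // andbT; apply/mem_set.
by move: iP; rewrite mem_iota => /aP [].
Qed.

(** Labels are injective on [A], so [n] members below [k] already use up all the labels below
    [n]. *)
Lemma missing_label G n lab A r k i : labelling G n lab ->
  maximal_antichain G A -> set_name r A -> missing n r k = 0 -> i < n ->
  exists2 a, A a & a < k /\ lab a = i.
Proof.
move=> labP Amax rA /eqP; rewrite subn_eq0 (sum_mem _ rA) => le_n ni.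
have [AG Ainj Asurj] := maximal_antichainP labP Amax.
have [_ labn _] := labP; pose L := [seq b <- iota 0 k | b \in A].
have Lu : uniq (map lab L).
  rewrite map_inj_in_uniq ?filter_uniq ?iota_uniq // => x y.
  by rewrite !mem_filter => /andP[xA _] /andP[yA _]; exact: Ainj.
have Lsub : {subset map lab L <= iota 0 n}.
  move=> _ /mapP [x + ->]; rewrite mem_filter !mem_iota.
  move=> /andP[/set_mem/AG Gx _].
  exact: labn.
have [|_ LE] := uniq_min_size Lu Lsub; first by rewrite size_iota size_map.
have := LE i; rewrite mem_iota /= ni => /mapP [a + ->].
by rewrite mem_filter mem_iota => /andP[/set_mem Aa ak]; exists a.
Qed.

Lemma last_guess_correct n f m A r k : 1 < n -> ~ range f m ->
  (forall j, j < m -> range f j) ->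
  maximal_antichain (guess_graph n f) A -> set_name r A ->
  missing n r k = 0 -> last_guess r k = m.
Proof.
move=> n_gt1 fm fltm Amax rA rk.
have labP := guess_labelling n_gt1 fm fltm.
have n1_gt0 : 0 < n.-1 by rewrite -subn1 subn_gt0.
have [|a Aa [ak aE]] := @missing_label _ _ _ _ _ _ n.-1 labP Amax rA rk.
  by rewrite prednK // ltnW.
have [AG _ _] := maximal_antichainP labP Amax.
have a2 : unpair2 a = m.+1.
  have /= := AG _ Aa; move: aE; rewrite /guess_label /guess_vertex.
  case: (unpair2 a) => [|c] /= aE; first by rewrite aE ltnn.
  by move: aE; case: eqP => [->//|_ n0]; rewrite -n0 in n1_gt0.
(* The bound [k] must exceed [m] for the count to reach [m]; it exceeds the code [a], which bounds
   its second component [m.+1]. *)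
have mk : m < k.
  rewrite -a2; apply: leq_trans (ltnW ak); rewrite -[X in _ <= X]pair_unpair.
  exact: leq_trans (leq_addl _ _) (cantor_pair_geq _ _).
(* [m] is rewritten as the number of [c < k] with [c < m], to be compared with the count term by
   term. *)
rewrite /last_guess -[RHS]card_ord -sum1_card -(big_mkord xpredT (fun=> 1)).
rewrite (big_nat_widen _ _ _ _ _ (ltnW mk)) [RHS]big_mkcond /=.
apply: eq_big_nat => c /andP[_ ck]; case: ltnP => cm.
  have -> // : has (fun b => (r b != 0) && (c.+1 < unpair2 b)) (iota 0 k).
  apply/hasP; exists a; first by rewrite mem_iota.
  by rewrite (set_name_neq0 _ rA) mem_set //= a2 ltnS.
apply/eqP; rewrite eqb0; apply/hasPn => b _.
rewrite (set_name_neq0 _ rA) negb_and -leqNgt; apply/orP.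
case: (boolP (b \in A)) => [/set_mem/AG/(guess_vertex_leq fm) bm|]; [right|by left].
by move: bm; case: (unpair2 b) => //= d dm; rewrite ltnS (leq_trans dm).
Qed.

Lemma C_N_reducible_GAC n : 1 < n -> sW_reducible C_N (GAC n).
Proof.
move=> n_gt1; have [Phi PhiP] := guess_computed n.
have [Psi PsiP] := search_last_guess n.
exists Phi, Psi => p f /= pf; have {f pf} <- : p = f by apply/funext.
move=> [m0 fm0].
have ex : exists m, `[< ~ range p m >] by exists m0; apply/asboolP.
case: (ex_minnP ex) => m /asboolP fm mmin.
have fltm j : j < m -> range p j.
  move=> jm; apply: contrapT => pj.
  by have := mmin j (introT (asboolP _) pj); rewrite leqNgt jm.
have labP := guess_labelling n_gt1 fm fltm.
eexists _, (guess_graph n p); split; first exact: PhiP.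
- split=> [v|u v].
    rewrite /even_part odd_double doubleK; congr nat_of_bool.
    by apply/idP/idP => [|/set_mem]; [move=> H; apply/mem_set|].
  rewrite /odd_part /= odd_double /= uphalf_double unpair1K unpair2K.
  congr nat_of_bool.
  by apply/idP/idP => [H|/set_mem]; [apply/mem_set|].
- by apply/card_componentsP; exists (guess_label n m).
(* The backward program ignores its argument, so its output is the constant sequence [m]. *)
move=> r A rA Amax; exists (fun=> m), m; split=> // k.
have ex0 : exists k, missing n r k == 0.
  by have [j /eqP] := missing_eq0 labP Amax rA; exists j.
case: (ex_minnP ex0) => j /eqP j0 jmin.
rewrite -(last_guess_correct n_gt1 fm fltm Amax rA j0).
by apply: PsiP => // i ij /eqP /jmin; rewrite leqNgt ij.
Qed.

Theorem theorem3p5 (n : nat) (hn : 2 <= n) :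
  sW_equiv (GAC n) (EMB n) /\ sW_equiv (EMB n) C_N.
Proof.
have GE := GAC_reducible_EMB n.
have EC := EMB_reducible_C_N (ltnW hn).
have CG := C_N_reducible_GAC hn.
split; split=> //; first exact: sW_reducible_trans EC CG.
exact: sW_reducible_trans CG GE.
Qed.
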